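(* Let $S$ be a sequence of policy values in $V_6$. Then $$\delta\Bigl(\bigoplus\nolimits_{\mathbf{d\text{-}o}}^{V_6}(S)\Bigr) = \bigoplus\nolimits_{\mathbf{d\text{-}o}}^{\mathbf{P}}(\delta(S)).$$
   Context: $V_6 = \{\top_{\mathbf{p}}, \top_{\mathbf{d}}, I_{\mathbf{d}}, I_{\mathbf{p}}, I_{\mathbf{dp}}, \bot\}$ is a set of six distinct values (policy values). The set of pairwise policy values is $\mathbf{P} = \{[0,0], [\frac12,0], [0,\frac12], [\frac12,\frac12], [1,0], [0,1]\}$; for a pair write $d([D,P]) = D$ and $p([D,P]) = P$. Sequences are written $\langle s_1, \ldots, s_n\rangle$. The map $\delta : V_6 \to \mathbf{P}$ is: $\delta(\bot) = [0,0]$, $\delta(I_{\mathbf{d}}) = [\frac12,0]$, $\delta(I_{\mathbf{p}}) = [0,\frac12]$, $\delta(I_{\mathbf{dp}}) = [\frac12,\frac12]$, $\delta(\top_{\mathbf{d}}) = [1,0]$, $\delta(\top_{\mathbf{p}}) = [0,1]$. On sequences $\delta$ is applied elementwise: $\delta(\langle s_1,\dots,s_n\rangle) = \langle \delta(s_1), \dots, \delta(s_n)\rangle$. For a set $X \subseteq \mathbf{P}$, $\mathit{Max}(X) = [\max\{d(x) \mid x \in X\}, \max\{p(x) \mid x \in X\}]$, the componentwise maximum (a pair with entries in $\{0,\frac12,1\}$). Deny-overrides under $V_6$. Let $\sqsubseteq_{\mathbf{d\text{-}o}}$ be the lattice order on $V_6$ whose covering relations are: $\bot < I_{\mathbf{d}}$,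 $\bot < I_{\mathbf{p}}$, $I_{\mathbf{p}} < \top_{\mathbf{p}}$, $\top_{\mathbf{p}} < I_{\mathbf{dp}}$, $I_{\mathbf{d}} < I_{\mathbf{dp}}$, $I_{\mathbf{dp}} < \top_{\mathbf{d}}$. For a sequence $S = \langle s_1, \ldots, s_n\rangle$ in $V_6$, $\bigoplus_{\mathbf{d\text{-}o}}^{V_6}(S)$ is the least upper bound of $\{s_1, \ldots, s_n\}$ with respect to $\sqsubseteq_{\mathbf{d\text{-}o}}$. Deny-overrides under $\mathbf{P}$. For a sequence $S = \langle s_1, \ldots, s_n\rangle$ in $\mathbf{P}$ with $S' = \{s_1, \ldots, s_n\}$, $$\bigoplus\nolimits_{\mathbf{d\text{-}o}}^{\mathbf{P}}(S) = \begin{cases} [1,0] & \text{if } \mathit{Max}(S') = [1,P] \text{ for some } P, \\ [\frac12,\frac12] & \text{if } \mathit{Max}(S') = [\frac12,P] \text{ with } P \geq \frac12, \\ \mathit{Max}(S') & \text{otherwise.} \end{cases}$$ *)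

(* Defs.v *)
From HB Require Import structures.
From mathcomp Require Import all_boot all_order all_algebra.
Set Implicit Arguments.
Unset Strict Implicit.
Unset Printing Implicit Defensive.
Import Order.TTheory GRing.Theory Num.Theory.
Local Open Scope ring_scope.

Inductive V6 := TopP | TopD | IndD | IndP | IndDP | Bot.

Definition V6_code (x : V6) : 'I_6 :=
  match x with
  | TopP => inord 0 | TopD => inord 1 | IndD => inord 2
  | IndP => inord 3 | IndDP => inord 4 | Bot => inord 5
  end.

Definition V6_decode (i : 'I_6) : V6 :=
  nth Bot [:: TopP; TopD; IndD; IndP; IndDP; Bot] i.

Lemma V6_codeK : cancel V6_code V6_decode.
Proof. by case; rewrite /V6_decode /= inordK. Qed.

HB.instance Definition _ := Finite.copy V6 (can_type V6_codeK).

(* Covering relations of the deny-overrides order; the order itself is their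
   reflexive transitive closure. *)
Definition do_cover : rel V6 := fun x y =>
  match x, y with
  | Bot, IndD | Bot, IndP | IndP, TopP | TopP, IndDP | IndD, IndDP
  | IndDP, TopD => true
  | _, _ => false
  end.

Definition do_le : rel V6 := connect do_cover.

(* The lattice operations exploit that the only incomparable pairs are
   {IndD, IndP} and {IndD, TopP}; both have join IndDP and meet Bot. *)
Definition do_le_table (x y : V6) : bool :=
  match x, y with
  | Bot, _ | _, TopD => true
  | IndD, (IndD | IndDP) => true
  | IndP, (IndP | TopP | IndDP) => true
  | TopP, (TopP | IndDP) => true
  | IndDP, IndDP => true
  | _, _ => false
  end.

Definition do_join (x y : V6) : V6 :=
  if do_le_table x y then y else if do_le_table y x then x else IndDP.

Definition do_meet (x y : V6) : V6 :=
  if do_le_table x y then x else if do_le_table y x then y else Bot.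

Lemma do_leE x y : do_le x y = do_le_table x y.
Proof.
apply/idP/idP.
  case/connectP=> p; elim: p x => [|z p IHp] x /=; first by move=> _ ->; case: x.
  case/andP=> xz zp yE; have := IHp z zp yE.
  by clear - xz; case: x z y xz => [] [] [].
have c u v : do_cover u v -> do_le u v by exact: connect1.
have t : transitive do_le by move=> ? ? ?; apply: connect_trans.
have H1 : do_le Bot IndD by apply: c.
have H2 : do_le Bot IndP by apply: c.
have H3 : do_le IndP TopP by apply: c.
have H4 : do_le TopP IndDP by apply: c.
have H5 : do_le IndD IndDP by apply: c.
have H6 : do_le IndDP TopD by apply: c.
have H7 := t _ _ _ H3 H4; have H8 := t _ _ _ H7 H6.
have H9 := t _ _ _ H4 H6; have H10 := t _ _ _ H5 H6.
have H11 := t _ _ _ H2 H3; have H12 := t _ _ _ H2 H7.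
have H13 := t _ _ _ H2 H8.
by case: x y => [] [] // _; exact: connect0.
Qed.

Lemma do_le_refl : reflexive do_le.
Proof. exact: connect0. Qed.

Lemma do_le_anti : antisymmetric do_le.
Proof. by move=> x y; rewrite !do_leE; case: x y => [] []. Qed.

Lemma do_le_trans : transitive do_le.
Proof. by move=> y x z; apply: connect_trans. Qed.

Fact do_display : Order.disp_t. Proof. exact: Order.Disp tt tt. Qed.

HB.instance Definition _ :=
  Order.Le_isPOrder.Build do_display V6 do_le_refl do_le_anti do_le_trans.

Lemma do_meetP x y z : do_le x (do_meet y z) = do_le x y && do_le x z.
Proof. by rewrite !do_leE; case: x y z => [] [] []. Qed.

Lemma do_joinP x y z : do_le (do_join x y) z = do_le x z && do_le y z.
Proof. by rewrite !do_leE; case: x y z => [] [] []. Qed.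

HB.instance Definition _ :=
  Order.POrder_MeetJoin_isLattice.Build do_display V6 do_meetP do_joinP.

Lemma do_le0x x : do_le Bot x.
Proof. by rewrite do_leE; case: x. Qed.

HB.instance Definition _ := Order.hasBottom.Build do_display V6 do_le0x.

(* The least upper bound of the entries of S; it is Bot when S is empty. *)
Definition oplus_do_V6 (S : seq V6) : V6 := (\join_(s <- S) s)%O.

Definition pairwise_values : seq (rat * rat) :=
  [:: (0, 0); (2^-1, 0); (0, 2^-1); (2^-1, 2^-1); (1, 0); (0, 1)].

Definition PV : finType := seq_sub pairwise_values.

Definition dval (x : PV) : rat := (val x).1.
Definition pval (x : PV) : rat := (val x).2.

(* [mkPV a] pairs a with a proof, found by evaluation, that it is one of the
   six pairwise values. *)
Notation mkPV a := (SeqSub (isT : a \in pairwise_values)).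

Definition delta (x : V6) : PV :=
  match x with
  | Bot => mkPV (0, 0)
  | IndD => mkPV (2^-1, 0)
  | IndP => mkPV (0, 2^-1)
  | IndDP => mkPV (2^-1, 2^-1)
  | TopD => mkPV (1, 0)
  | TopP => mkPV (0, 1)
  end.

(* All entries are nonnegative, so the base value 0 changes nothing for
   nonempty X; it gives MaxP set0 = (0, 0). *)
Definition MaxP (X : {set PV}) : rat * rat :=
  (\big[Num.max/0]_(x in X) dval x, \big[Num.max/0]_(x in X) pval x).

Definition oplus_do_P_val (S : seq PV) : rat * rat :=
  let M := MaxP [set s in S] in
  if M.1 == 1 then (1, 0)
  else if (M.1 == 2^-1) && (2^-1 <= M.2) then (2^-1, 2^-1)
  else M.

Lemma oplus_do_P_subproof (S : seq PV) : oplus_do_P_val S \in pairwise_values.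
Proof.
have H (f : PV -> rat) : (forall x, f x \in [:: 0; 2^-1; 1 : rat]) ->
    \big[Num.max/0]_(x in [set s in S]) f x \in [:: 0; 2^-1; 1 : rat].
  move=> fH; elim/big_ind: _ => // a b.
  by rewrite /Num.max; case: ifP.
have HD : forall x, dval x \in [:: 0; 2^-1; 1 : rat].
  by case=> x; rewrite /dval /= !inE; do ![case/orP]; move/eqP->.
have HP : forall x, pval x \in [:: 0; 2^-1; 1 : rat].
  by case=> x; rewrite /pval /= !inE; do ![case/orP]; move/eqP->.
rewrite /oplus_do_P_val /MaxP /=.
move: (H dval HD) (H pval HP); rewrite !inE.
by case/or3P=> /eqP->; case/or3P=> /eqP->.
Qed.

Definition oplus_do_P (S : seq PV) : PV := SeqSub (oplus_do_P_subproof S).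

(* Main.v *)
Require Import Defs.
From mathcomp Require Import all_boot all_order all_algebra.

Import Order.TTheory.

(** The rule turning [Max(S')] into a deny-overrides decision can be postponed:
    applying it to a partial maximum does not change the final decision. So the
    operator on pairs satisfies the same recursion along the sequence as the
    join, and it remains to compare the two on pairs of values. *)

Definition deny_rule (M : rat * rat) : rat * rat :=
  if M.1 == 1%R then (1, 0)%R
  else if (M.1 == 2^-1)%R && (2^-1 <= M.2)%R then (2^-1, 2^-1)%R
  else M.

Definition pair_max (a b : rat * rat) : rat * rat :=
  (Num.max a.1 b.1, Num.max a.2 b.2).

(** Repetitions do not affect a maximum, so [MaxP] can be computed by recursion along the
    sequence. *)
Lemma bigmax_set_seq (d : Order.disp_t) (T : orderType d) (I : finType)
    (x0 : T) (f : I -> T) (s : seq I) :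
  \big[Order.max/x0]_(i in [set i in s]) f i = \big[Order.max/x0]_(i <- s) f i.
Proof.
apply/le_anti/andP; split.
  apply/bigmax_leP; split=> [|i]; first exact: bigmax_ge_id.
  by rewrite inE => si; apply: le_bigmax_seq.
rewrite big_seq; apply: bigmax_le => [|i si]; first exact: bigmax_ge_id.
by apply: le_bigmax_cond; rewrite inE.
Qed.

Lemma MaxP_cons (x : PV) (s : seq PV) :
  MaxP [set y in x :: s] = pair_max (val x) (MaxP [set y in s]).
Proof. by rewrite /MaxP !bigmax_set_seq !big_cons. Qed.

(** The rule keeps the first component. It drops the second below 1/2 only when the first is 1,
    which already forces (1, 0). *)
Lemma deny_rule_pair_max (a M : rat * rat) :
  a \in pairwise_values ->
  M.1 \in [:: 0; 2^-1; 1]%R -> M.2 \in [:: 0; 2^-1; 1]%R ->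
  deny_rule (pair_max a (deny_rule M)) = deny_rule (pair_max a M).
Proof.
case: M => D P /=; rewrite !inE.
by do ![case/orP]; move/eqP=> ->; case/or3P=> /eqP->; case/or3P=> /eqP->.
Qed.

(** A maximum can leave the six pairs, as (1/2, 1) does, so only its components are constrained. *)
Lemma MaxP_entries (s : seq PV) :
  ((MaxP [set y in s]).1 \in [:: 0; 2^-1; 1]%R) /\
  ((MaxP [set y in s]).2 \in [:: 0; 2^-1; 1]%R).
Proof.
split; apply: (big_ind (fun r : rat => r \in [:: 0; 2^-1; 1]%R)) => //=.
- by move=> a b; rewrite /Num.max; case: ifP.
- by case=> x xP _; move: xP; rewrite /dval /= !inE; do ![case/orP]; move/eqP->.
- by move=> a b; rewrite /Num.max; case: ifP.
- by case=> x xP _; move: xP; rewrite /pval /= !inE; do ![case/orP]; move/eqP->.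
Qed.

(** [TopP] lies below [IndDP] and [TopD], although its second component is larger; the rule corrects
    the maxima (1/2, 1) and (1, 1) accordingly. *)
Lemma delta_join (x y : V6) :
  val (delta (x `|` y)%O) = deny_rule (pair_max (val (delta x)) (val (delta y))).
Proof. by case: x y => [] []. Qed.

Theorem proposition3 (S : seq V6) :
  delta (oplus_do_V6 S) = oplus_do_P (map delta S).
Proof.
apply: val_inj; rewrite -[RHS]/(deny_rule (MaxP [set y in map delta S])).
elim: S => [|x S IHS].
  (* On the empty sequence the defaults agree: [Bot] is sent to (0, 0), which the rule fixes. *)
  by rewrite /oplus_do_V6 big_nil /MaxP !bigmax_set_seq !big_nil.
have [D_in P_in] := MaxP_entries (map delta S).
rewrite /oplus_do_V6 big_cons delta_join -/(oplus_do_V6 S) IHS.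
rewrite map_cons MaxP_cons.
by rewrite deny_rule_pair_max //; apply: valP.
Qed.
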